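(* Let $\sigma\in C^1((0,1))$ be a positive function with $\int_0^1\sigma(t)\,dt=1$ such that $t\mapsto t\sigma'(t)/\sigma(t)$ is decreasing on $(0,1)$. Let $$f(z)=\int_0^1\frac{\sigma(t)\,dt}{1-tz},\qquad z\in\mathbb C\setminus[1,\infty),$$ and let $w(y):=|f(iy)|$ for $y>0$. Then the function $y\mapsto \dfrac{y\,w'(y)}{w(y)}$ is decreasing on $(0,\infty)$.
   Context: ''Decreasing'' is meant in the weak sense (non-increasing), both in the hypothesis and in the conclusion. *)

(* Defs.v *)
From HB Require Import structures.
From mathcomp Require Import all_boot all_order all_algebra.
From mathcomp Require Import all_classical all_reals all_analysis.
From mathcomp.real_closed Require Export complex.

Set Implicit Arguments.
Unset Strict Implicit.
Unset Printing Implicit Defensive.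

Import Order.TTheory GRing.Theory Num.Theory.
Import numFieldNormedType.Exports.

Local Open Scope classical_set_scope.
Local Open Scope ring_scope.
Local Open Scope complex_scope.

(* The Lebesgue integral of a complex-valued function, taken on real and
   imaginary parts. *)
Definition cintegral (R : realType) (D : set R) (h : R -> R[i]) : R[i] :=
  Rintegral (@lebesgue_measure R) D (fun t => complex.Re (h t)) +i*
  Rintegral (@lebesgue_measure R) D (fun t => complex.Im (h t)).

(* Meaningful for z outside [1, +oo[; the value elsewhere is junk. *)
Definition markov_transform (R : realType) (sigma : R -> R) (z : R[i]) : R[i] :=
  cintegral `]0, 1[ (fun t => (sigma t)%:C / (1 - t%:C * z)).

(* The modulus `|z| lives in R[i], with zero imaginary part, hence the Re. *)
Definition modulus_on_imaginary_axis (R : realType) (f : R[i] -> R[i]) (y : R) : R :=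
  complex.Re `|f ('i%C * y%:C)|.

(* Main.v *)
Require Import Defs.
From HB Require Import structures.
From mathcomp Require Import all_boot all_order all_algebra.
From mathcomp Require Import all_classical all_reals all_analysis.
From mathcomp Require Import measurable_realfun ring lra.

Import Order.TTheory GRing.Theory Num.Theory.
Import numFieldNormedType.Exports.

Local Open Scope classical_set_scope.
Local Open Scope ring_scope.

(** Both the hypothesis and the conclusion say that a function is log-concave in
    the variable [log t]. This property is stable under products, under
    [t -> 1/t], and under Mellin convolution with a kernel [k] such that
    [k (exp x)] is log-concave, in particular [1/(1+x)] and [1/(1+x^2)].
    The partial fraction identity
      (1 + t s y^2) / ((1 + t^2 y^2) (1 + s^2 y^2))
        = (t / (1 + t^2 y^2) + s / (1 + s^2 y^2)) / (t + s)
    and Tonelli's theorem turn the double integral |f(iy)|^2 into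
      2 \int_0^1 sigma(t) m(t) / (1 + t^2 y^2) dt,
      m(t) = \int_0^1 sigma(s) / (1 + s/t) ds = f(-1/t),
    so two successive convolutions show that |f(iy)|^2 is log-concave in
    [log y]. *)

(** * Measurability of the inverse and Lebesgue measure under dilation *)

Lemma measurable_funV (R : realType) : measurable_fun setT (fun x : R => x^-1).
Proof.
rewrite -(setUv [set (0 : R)]) setUC; apply/measurable_funU => //.
- exact: measurableC.
split; last exact: measurable_fun_set1.
apply: open_continuous_measurable_fun.
  by apply: closed_openC; exact: closed_eq.
by move=> x /set_mem/= /eqP x0; exact: inv_continuous.
Qed.

(** By uniqueness of Lebesgue measure: [l] times the pushforward gives every interval []a, b]] its
    length. *)
Lemma lebesgue_measure_scale (R : realType) (l : R) (A : set R) : 0 < l ->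
  measurable A ->
  pushforward lebesgue_measure ( *%R l : _ -> measurableTypeR R) A =
  (l^-1%:E * lebesgue_measure A)%E.
Proof.
move=> l0 mA.
have ml : measurable_fun setT ( *%R l : measurableTypeR R -> measurableTypeR R).
  exact: mulrl_measurable.
have [nu nuE] : exists nu : {measure set (measurableTypeR R) -> \bar R},
    forall B, nu B = (l%:E * lebesgue_measure ( *%R l @^-1` B))%E.
  by unshelve eexists (mscale (NngNum (ltW l0)) (pushforward lebesgue_measure
    ( *%R l : measurableTypeR R -> measurableTypeR R))).
have -> : lebesgue_measure A = nu A.
  apply: lebesgue_measure_unique => //= _ [[a b]] _ <-.
  rewrite nuE.
  have -> : *%R l @^-1` `]a, b] = `]a / l, b / l]%classic.
    apply/seteqP; split => x /=; rewrite !in_itv/= ltr_pdivrMr// ler_pdivlMr//;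
    by rewrite (mulrC x).
  rewrite !lebesgue_measure_itv/= !lte_fin ltr_pM2r ?invr_gt0//.
  case: ifPn => _; last by rewrite mule0.
  by rewrite -EFinB -EFinM; congr (_%:E); field; rewrite gt_eqF.
by rewrite nuE muleA -EFinM mulVf ?gt_eqF// mul1e.
Qed.

(* Concavity of [log (g (exp x))], stated without logarithms so that [g] may
   vanish outside an interval. *)
Definition log_concave_log {R : realType} (g : R -> R) :=
  forall t s l, 0 < t -> t <= s -> 1 <= l -> g (t / l) * g s <= g t * g (s / l).

(** * Single crossing of a log-concave function with its dilates *)

Section crossing.
Variables (R : realType) (g : R -> R).
Hypothesis g_ge0 : forall t, 0 <= g t.
Hypothesis g_supp : forall t, 1 <= t -> g t = 0.
Hypothesis g_lc : log_concave_log g.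

(** Log-concavity says that g (t / l) / g t increases with t wherever it is defined, so q * g (t /
    l) can only pass from below p * g t to above it. *)
Lemma single_crossing (p q l : R) : 0 <= p -> 0 <= q -> 1 <= l ->
  exists2 t0 : R, 0 <= t0 & forall t, 0 < t ->
    (t < t0 -> q * g (t / l) <= p * g t) /\
    (t0 < t -> p * g t <= q * g (t / l)).
Proof.
move=> p0 q0 l1.
(* The crossing point is the supremum of the points where p * g is strictly larger; such points have
   g t > 0, hence lie below 1. *)
pose S := [set t : R | 0 < t /\ q * g (t / l) < p * g t].
have pgS t : S t -> 0 < p * g t.
  by move=> [t0]; apply: le_lt_trans; rewrite mulr_ge0.
have ubS : ubound S 1.
  move=> t St; rewrite leNgt; apply/negP => t1.
  by have := pgS _ St; rewrite g_supp ?mulr0 ?ltxx// ltW.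
exists (sup S).
  (* The supremum of the empty set is 0 by convention, and no t > 0 lies below it. *)
  have [->|/set0P[t St]] := eqVneq S set0; first by rewrite sup0.
  by rewrite (le_trans (ltW St.1))//; apply: ub_le_sup => //; exists 1.
move=> t t0; split => [tS|tS]; last first.
  rewrite leNgt; apply/negP => Ut.
  have : t <= sup S by apply: ub_le_sup; [exists 1|].
  by rewrite leNgt tS.
have [s Ss ts] : exists2 s, S s & t < s.
  have S0 : S !=set0.
    apply/set0P/negP => /eqP S0; move: tS; rewrite S0 sup0 => /(lt_trans t0).
    by rewrite ltxx.
  by apply: sup_gt.
have := g_lc t s l t0 (ltW ts) l1 => glc.
have pgs := pgS _ Ss; have [s0 Us] := Ss.
rewrite -(ler_pM2r pgs).
have -> : q * g (t / l) * (p * g s) = q * p * (g (t / l) * g s) by ring.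
apply: (@le_trans _ _ (q * p * (g t * g (s / l)))).
  by apply: ler_wpM2l => //; exact: mulr_ge0.
have -> : q * p * (g t * g (s / l)) = p * g t * (q * g (s / l)) by ring.
by apply: ler_wpM2l; [exact: mulr_ge0|exact: ltW].
Qed.
End crossing.

(** * Change of variables and elementary integrability *)

Lemma ge0_integral_scale (R : realType) (l : R) (f : R -> \bar R) : 0 < l ->
  measurable_fun setT f -> (forall x, (0 <= f x)%E) ->
  (\int[lebesgue_measure]_x f (l * x)%R =
   l^-1%:E * \int[lebesgue_measure]_x f x)%E.
Proof.
move=> l0 mf f0.
have ml : measurable_fun setT ( *%R l : measurableTypeR R -> measurableTypeR R).
  exact: mulrl_measurable.
have li0 : 0 <= l^-1 by rewrite invr_ge0 ltW.
have := @ge0_integral_pushforward _ _ (measurableTypeR R) (measurableTypeR R) R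
  ( *%R l) ml lebesgue_measure setT f measurableT mf (fun x _ => f0 x).
rewrite preimage_setT => <-.
have := @ge0_integral_mscale _ (measurableTypeR R) R lebesgue_measure setT
  measurableT (NngNum li0) f mf (fun x _ => f0 x) => <-.
by apply: eq_measure_integral => //= A mA _; exact: lebesgue_measure_scale.
Qed.

Lemma Rintegrable_measurable (R : realType) (f : R -> R) :
  lebesgue_measure.-integrable setT (EFin \o f) -> measurable_fun setT f.
Proof. by case/integrableP => /measurable_EFinP. Qed.

Lemma integrable_comb2 (R : realType) (f h : R -> R) (c d : R) :
  lebesgue_measure.-integrable setT (EFin \o f) ->
  lebesgue_measure.-integrable setT (EFin \o h) ->
  lebesgue_measure.-integrable setT (EFin \o (fun x => c * f x + d * h x)).
Proof.
move=> intf inth.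
have -> : EFin \o (fun x => c * f x + d * h x) =
    ((fun x => c%:E * (EFin \o f) x) \+ (fun x => d%:E * (EFin \o h) x))%E by [].
by apply: integrableD => //; exact: integrableZl.
Qed.

Lemma Rintegral_comb2 (R : realType) (f h : R -> R) (c d : R) :
  lebesgue_measure.-integrable setT (EFin \o f) ->
  lebesgue_measure.-integrable setT (EFin \o h) ->
  \int[lebesgue_measure]_x (c * f x + d * h x) =
  c * \int[lebesgue_measure]_x f x + d * \int[lebesgue_measure]_x h x.
Proof.
move=> intf inth; rewrite RintegralD//.
- by rewrite !RintegralZl.
- exact: (integrableZl measurableT c intf).
- exact: (integrableZl measurableT d inth).
Qed.

Lemma integrable_mulk (R : realType) (g k : R -> R) :
  measurable_fun setT k -> (forall x, 0 <= k x <= 1) ->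
  lebesgue_measure.-integrable setT (EFin \o g) ->
  lebesgue_measure.-integrable setT (EFin \o (fun t => g t * k t)).
Proof.
move=> mk k01 intg.
apply: (le_integrable measurableT _ _ intg).
  apply/measurable_EFinP/measurable_funM => //.
  exact: Rintegrable_measurable intg.
move=> x _; rewrite /= lee_fin normrM ler_piMr// ger0_norm//.
- by have /andP[] := k01 x.
- by have /andP[] := k01 x.
Qed.

(** * Mellin convolution preserves log-concavity *)

Section mellin_convolution.
Variables (R : realType) (g k : R -> R).
Hypothesis g_ge0 : forall t, 0 <= g t.
Hypothesis g_le0 : forall t, t <= 0 -> g t = 0.
Hypothesis g_ge1 : forall t, 1 <= t -> g t = 0.
Hypothesis g_lc : log_concave_log g.
Hypothesis g_int : lebesgue_measure.-integrable setT (EFin \o g).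
Hypothesis k_meas : measurable_fun setT k.
Hypothesis k01 : forall x, 0 <= k x <= 1.
Hypothesis k_gt0 : forall x, 0 < k x.
Hypothesis k_tp : forall t s x y, 0 <= t -> t <= s -> 0 < x -> x <= y ->
  k (t * x) * k (s * y) <= k (s * x) * k (t * y).

Lemma integrable_gk y :
  lebesgue_measure.-integrable setT (EFin \o (fun t => g t * k (t * y))).
Proof.
apply: (@integrable_mulk R g (fun t => k (t * y))) => //.
by apply: measurableT_comp => //; exact: mulrr_measurable.
Qed.

(** Substitution t = l * x. The integrand is non-negative, so the identity holds first in the
    extended reals; finiteness of the right side then gives integrability on the left. *)
Lemma integral_gk_scale l y : 0 < l ->
  lebesgue_measure.-integrable setT (EFin \o (fun t => g (t / l) * k (t * y))) /\
  \int[lebesgue_measure]_t (g (t / l) * k (t * y)) =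
  l * \int[lebesgue_measure]_t (g t * k (t * (l * y))).
Proof.
move=> l0.
have mg : measurable_fun setT g by exact: Rintegrable_measurable g_int.
pose f t : \bar R := (g (t / l) * k (t * y))%:E.
have mf : measurable_fun setT f.
  apply/measurable_EFinP/measurable_funM; apply: measurableT_comp => //;
  exact: mulrr_measurable.
have f0 x : (0 <= f x)%E.
  by rewrite /f lee_fin mulr_ge0//; have /andP[] := k01 (x * y).
have := ge0_integral_scale _ _ _ l0 mf f0.
under eq_integral => x _.
  rewrite /f mulrAC divff ?gt_eqF// mul1r (_ : l * x * y = x * (l * y)); last by ring.
  over.
move=> /(congr1 (fun z => l%:E * z)%E); rewrite muleA -EFinM divff ?gt_eqF// mul1e => E.
split.
  apply/integrableP; split => //.
  rewrite (_ : (\int[_]_x _)%E = \int[lebesgue_measure]_x f x)%E; last first.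
    by apply: eq_integral => x _; rewrite gee0_abs//; exact: f0.
  rewrite -E.
  have := integrable_fin_num measurableT (integrable_gk (l * y)) => /= h.
  by rewrite ltey_eq fin_numM.
rewrite /Rintegral -/f -E fineM//.
exact: (integrable_fin_num measurableT (integrable_gk (l * y))).
Qed.

(* With I the integral, [y := t / l] and [z := s / l], so [y <= z], the function
     [u x = I y * g (x / l) / l - I (l * y) * g x]
   changes sign once, from - to +, say at t1, and [\int u x * k (x * y) dx = 0].
   Since [k (x * z) / k (x * y)] decreases in [x], replacing it by its value at
   t1 shows [\int u x * k (x * z) dx <= 0], which is the claim. *)
Lemma log_concave_log_integral :
  log_concave_log (fun y => \int[lebesgue_measure]_t (g t * k (t * y))).
Proof.
move=> t s l t0 ts l1.
have l0 : 0 < l by apply: lt_le_trans l1.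
pose I y := \int[lebesgue_measure]_t (g t * k (t * y)).
have I0 y : 0 <= I y.
  by apply: Rintegral_ge0 => x _; rewrite mulr_ge0//; have /andP[] := k01 (x * y).
change (I (t / l) * I s <= I t * I (s / l)).
pose y := t / l; pose z := s / l.
have y0 : 0 < y by rewrite divr_gt0.
have yz : y <= z by rewrite ler_pM2r// invr_gt0.
have tE : t = l * y by rewrite /y mulrC divfK// gt_eqF.
have sE : s = l * z by rewrite /z mulrC divfK// gt_eqF.
rewrite -/y -/z; pose p := I t; pose q := I y / l.
have q0 : 0 <= q by rewrite divr_ge0// ltW.
have [t1 t10 cross] := single_crossing _ _ g_ge0 g_ge1 g_lc p q l (I0 t) q0 l1.
pose a := k (t1 * y); pose b := k (t1 * z).
have [iy Ey] := integral_gk_scale l y l0.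
have [iz Ez] := integral_gk_scale l z l0.
(* The integrated form of u x * (a * k (x * z) - b * k (x * y)) <= 0: the two factors change sign at
   [t1] in opposite directions. *)
have main : (q * a) * (l * I s) + (p * b) * I y <= (p * a) * I z + (q * b) * (l * I t).
  rewrite tE sE /I -Ey -Ez -!Rintegral_comb2//; try exact: integrable_gk.
  apply: le_Rintegral => //; try (apply: integrable_comb2 => //; exact: integrable_gk).
  move=> x _; rewrite -subr_le0.
  rewrite (_ : _ - _ = (q * g (x / l) - p * g x) *
    (a * k (x * z) - b * k (x * y))); last by ring.
  have [x0|x0] := leP x 0.
    rewrite !g_le0 ?mulr0 ?subrr ?mul0r//.
    by rewrite mulr_le0_ge0// invr_ge0 ltW.
  have [c1 c2] := cross x x0.
  have [xt|tx|->] := ltgtP x t1.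
  - rewrite mulr_le0_ge0 ?subr_le0 ?c1// subr_ge0 /a /b mulrC.
    by apply: k_tp => //; exact: ltW.
  - rewrite mulr_ge0_le0 ?subr_ge0 ?c2// subr_le0 /a /b.
    by rewrite [leRHS]mulrC; apply: k_tp => //; exact: ltW.
  - by rewrite [b * _]mulrC subrr mulr0.
(* This makes the two [b] terms of [main] equal; after cancelling them only the positive factor [a]
   remains to be divided out. *)
have qE : q * l = I y by rewrite /q divfK// gt_eqF.
rewrite -(ler_pM2r (k_gt0 (t1 * y))) -/a.
have : (q * l) * I s * a + I y * I t * b <= I t * I z * a + (q * l) * I t * b.
  by move: main; rewrite /p; lra.
by rewrite qE lerD2r.
Qed.

End mellin_convolution.

(** * Operations preserving log-concavity, and the differential criterion *)

Lemma log_concave_logM (R : realType) (f g : R -> R) :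
  (forall t, 0 <= f t) -> (forall t, 0 <= g t) ->
  log_concave_log f -> log_concave_log g ->
  log_concave_log (fun t => f t * g t).
Proof.
move=> f0 g0 fl gl t s l t0 ts l1.
by rewrite mulrACA [leRHS]mulrACA ler_pM ?mulr_ge0 ?fl ?gl.
Qed.

(** Inversion reflects the variable log t, so the inequality for [f] is used at the points l / s <=
    l / t. *)
Lemma log_concave_logV (R : realType) (f : R -> R) :
  log_concave_log f -> log_concave_log (fun t => f t^-1).
Proof.
move=> fl t s l t0 ts l1.
have l0 : 0 < l by apply: lt_le_trans l1.
have s0 : 0 < s by apply: lt_le_trans ts.
have := fl (s / l)^-1 (t / l)^-1 l.
have E x : 0 < x -> (x / l)^-1 / l = x^-1 by move=> x0; field; rewrite !gt_eqF.
rewrite (E s s0) (E t t0) (mulrC (f s^-1)) (mulrC (f (s / l)^-1)); apply => //.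
  by rewrite invr_gt0 divr_gt0.
by rewrite lef_pV2 ?posrE ?divr_gt0// ler_pM2r// invr_gt0.
Qed.

(** With phi t = t * sigma' t / sigma t, the derivative of q x = ln (sigma x) - ln (sigma (x / l))
    is (phi x - phi (x / l)) / x, which is <= 0 because x / l <= x. Hence q s <= q t, and
    exponentiating gives the claim. *)
Lemma log_concave_log_of_derive (R : realType) (sigma : R -> R) :
  (forall t : R, 0 < t < 1 -> 0 < sigma t) ->
  (forall t : R, 0 < t < 1 -> derivable sigma t 1) ->
  {in `]0, 1[%R &,
    nonincreasing_fun (fun t : R => t * derive1 sigma t / sigma t)} ->
  forall t s l : R, 0 < t -> t <= s -> s < 1 -> 1 <= l ->
  sigma (t / l) * sigma s <= sigma t * sigma (s / l).
Proof.
move=> pos der dec t s l t0 ts s1 l1.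
have l0 : 0 < l by apply: lt_le_trans l1.
have divl (x : R) : 0 < x < 1 -> 0 < x / l < 1.
  move=> /andP[x0 x1]; rewrite divr_gt0//= ltr_pdivrMr// mul1r.
  exact: lt_le_trans l1.
pose q x := ln (sigma x) - ln (sigma (x / l)).
have dq (x : R) : 0 < x < 1 -> is_derive x 1 q
    ((sigma x)^-1 * derive1 sigma x -
     (sigma (x / l))^-1 * (derive1 sigma (x / l) * l^-1)).
  move=> x01; have xl01 := divl _ x01.
  have d1 : is_derive x 1 sigma (derive1 sigma x).
    by apply: DeriveDef; [exact: der|rewrite derive1E].
  have d2 : is_derive (x / l) 1 sigma (derive1 sigma (x / l)).
    by apply: DeriveDef; [exact: der|rewrite derive1E].
  have d3 : is_derive x 1 (fun x : R => x / l) l^-1.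
    apply/is_derive1_caratheodory; exists (cst l^-1); split => //.
    - by move=> z; rewrite -mulrBl mulrC.
    - exact: cst_continuous.
  apply: is_deriveB.
    by apply: (@is_derive1_comp _ (@ln R) sigma) => //; apply: is_derive1_ln; exact: pos.
  apply: (@is_derive1_comp _ (@ln R) (fun x => sigma (x / l))).
    by apply: is_derive1_ln; exact: pos.
have t01 : 0 < t < 1 by rewrite t0 (le_lt_trans ts).
have s01 : 0 < s < 1 by rewrite s1 (lt_le_trans t0).
have : q s <= q t.
  apply: (@ler0_derive1_le_oo _ q 0 1) => //; rewrite ?in_itv//=.
  - by move=> x; rewrite in_itv/= => /dq[].
  - move=> x; rewrite in_itv/= => x01.
    rewrite derive1E (@derive_val _ _ _ _ _ _ _ (dq _ x01)).
    have /andP[x0 _] := x01; rewrite -(pmulr_rle0 _ x0).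
    have := dec (x / l) x; rewrite !in_itv/= => /(_ (divl _ x01) x01).
    have xlx : x / l <= x by rewrite ler_pdivrMr// ler_peMr// ltW.
    move=> /(_ xlx) h.
    rewrite (_ : x * (_ - _) = x * derive1 sigma x / sigma x -
      x / l * derive1 sigma (x / l) / sigma (x / l)); last by ring.
    by rewrite subr_le0.
  - move=> x; rewrite inE/= in_itv/= => /dq[+ _].
    by move=> /derivable1_diffP/differentiable_continuous.
rewrite /q => qst; rewrite -ler_ln ?posrE ?mulr_gt0 ?pos ?divl//.
by rewrite !lnM ?posrE ?pos ?divl//; lra.
Qed.

(* The absolute values in [kernel1] and [kernel3] only matter for [x < 0]: they
   give bounds on the whole line, which simplifies integrability. *)
Definition kernel1 {R : realType} (x : R) : R := (1 + `|x|)^-1.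
Definition kernel2 {R : realType} (x : R) : R := (1 + x ^+ 2)^-1.

(** * The kernels: bounds, measurability, log-concavity *)

Section kernels.
Variable R : realType.
Implicit Types x y t s : R.

Lemma kernel1_gt0 x : 0 < kernel1 x.
Proof. by rewrite invr_gt0 ltr_pwDl. Qed.

Lemma kernel2_gt0 x : 0 < kernel2 x.
Proof. by rewrite invr_gt0 ltr_pwDl// sqr_ge0. Qed.

Lemma kernel1_01 x : 0 <= kernel1 x <= 1.
Proof. by rewrite ltW ?kernel1_gt0//= invf_le1 ?lerDl// ltr_pwDl. Qed.

Lemma kernel2_01 x : 0 <= kernel2 x <= 1.
Proof. by rewrite ltW ?kernel2_gt0//= invf_le1 ?lerDl ?sqr_ge0// ltr_pwDl// sqr_ge0. Qed.

Lemma measurable_kernel1 : measurable_fun setT (@kernel1 R).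
Proof.
apply: measurableT_comp; first exact: measurable_funV.
exact: measurable_funD.
Qed.

Lemma measurable_kernel2 : measurable_fun setT (@kernel2 R).
Proof.
apply: measurableT_comp; first exact: measurable_funV.
by apply: measurable_funD => //; exact: measurable_funX.
Qed.

(** For t > 0 this is log-concavity of [kernel1] after exp: t * x and s * y are the outer points, s
    * x and t * y the inner ones, with equal products. Clearing denominators leaves (s - t) * (y -
    x) >= 0. *)
Lemma kernel1_tp t s x y : 0 <= t -> t <= s -> 0 < x -> x <= y ->
  kernel1 (t * x) * kernel1 (s * y) <= kernel1 (s * x) * kernel1 (t * y).
Proof.
move=> t0 ts x0 xy.
have s0 : 0 <= s by apply: le_trans ts.
have y0 : 0 <= y by rewrite (le_trans _ xy)// ltW.
have p u v : 0 <= u -> 0 <= v -> 0 < 1 + u * v.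
  by move=> u0 v0; rewrite ltr_pwDl ?mulr_ge0.
rewrite /kernel1 !ger0_norm ?mulr_ge0 ?(ltW x0)// -!invfM.
rewrite lef_pV2 ?posrE ?mulr_gt0 ?p ?(ltW x0)//.
rewrite -subr_ge0.
have -> : (1 + t * x) * (1 + s * y) - (1 + s * x) * (1 + t * y) =
  (s - t) * (y - x) by ring.
by rewrite mulr_ge0 ?subr_ge0.
Qed.

Lemma kernel2_tp t s x y : 0 <= t -> t <= s -> 0 < x -> x <= y ->
  kernel2 (t * x) * kernel2 (s * y) <= kernel2 (s * x) * kernel2 (t * y).
Proof.
move=> t0 ts x0 xy.
have s0 : 0 <= s by apply: le_trans ts.
have y0 : 0 <= y by rewrite (le_trans _ xy)// ltW.
have p u : 0 < 1 + u ^+ 2 :> R by rewrite ltr_pwDl ?sqr_ge0.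
rewrite /kernel2 -!invfM lef_pV2 ?posrE ?mulr_gt0 ?p// -subr_ge0.
have -> : (1 + (t * x) ^+ 2) * (1 + (s * y) ^+ 2) -
    (1 + (s * x) ^+ 2) * (1 + (t * y) ^+ 2) =
  (s ^+ 2 - t ^+ 2) * (y ^+ 2 - x ^+ 2) by ring.
by rewrite mulr_ge0 ?subr_ge0 ?ler_sqr ?nnegrE// ltW.
Qed.

End kernels.

(** For x >= 0, 1 / (1 - i x) has real part [kernel2 x] and imaginary part [kernel3 x]. *)
Definition kernel3 {R : realType} (x : R) : R := `|x| / (1 + x ^+ 2).

Lemma kernel3_01 (R : realType) (x : R) : 0 <= kernel3 x <= 1.
Proof.
have h : 0 < 1 + x ^+ 2 by rewrite ltr_pwDl ?sqr_ge0.
rewrite /kernel3 divr_ge0 ?(ltW h)//= ler_pdivrMr// mul1r -real_normK ?num_real//.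
by have := sqr_ge0 (`|x| - 1); have := normr_ge0 x; nra.
Qed.

Lemma measurable_kernel3 (R : realType) : measurable_fun setT (@kernel3 R).
Proof.
apply: measurable_funM; first exact: normr_measurable.
exact: measurable_kernel2.
Qed.

(** For [g] the extension of [sigma] by zero and y > 0 this is f(-y), so that m(t) =
    [stieltjes g t^-1] for t > 0. *)
Definition stieltjes {R : realType} (g : R -> R) (y : R) :=
  \int[lebesgue_measure]_s (g s * kernel1 (s * y)).

(** * The squared modulus as a single integral *)

Section square_modulus.
Variables (R : realType) (g : R -> R).
Hypothesis g_ge0 : forall t, 0 <= g t.
Hypothesis g_le0 : forall t, t <= 0 -> g t = 0.
Hypothesis g_int : lebesgue_measure.-integrable setT (EFin \o g).
Hypothesis g_int1 : \int[lebesgue_measure]_t g t = 1.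

Lemma stieltjes_01 y : 0 <= stieltjes g y <= 1.
Proof.
rewrite -g_int1; apply/andP; split.
  by apply: Rintegral_ge0 => x _; rewrite mulr_ge0// ltW// kernel1_gt0.
apply: le_Rintegral => //.
  apply: (@integrable_gk _ g _ g_int (@measurable_kernel1 R)).
  exact: kernel1_01.
by move=> x _; rewrite ler_piMr//; have /andP[] := kernel1_01 _ (x * y).
Qed.

(** Tonelli's theorem includes measurability of the partial integral of a non-negative function;
    [fine] brings it back to the reals. *)
Lemma measurable_stieltjes : measurable_fun setT (stieltjes g).
Proof.
have mg := Rintegrable_measurable _ _ g_int.
pose F (p : measurableTypeR R * measurableTypeR R) : \bar R :=
  (g p.2 * kernel1 (p.2 * p.1))%:E.
have mF : measurable_fun setT F.
  apply/measurable_EFinP/measurable_funM.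
    by apply: measurableT_comp => //; exact: measurable_snd.
  apply: measurableT_comp; first exact: measurable_kernel1.
  by apply: measurable_funM; [exact: measurable_snd|exact: measurable_fst].
have F0 p : (0 <= F p)%E by rewrite lee_fin mulr_ge0// ltW// kernel1_gt0.
have := measurable_fun_fubini_tonelli_F (m2 := @lebesgue_measure R) F mF F0.
move=> /(measurableT_comp (@fine_measurable R setT measurableT)).
by apply.
Qed.

Lemma integrable_g_stieltjes :
  lebesgue_measure.-integrable setT (EFin \o (fun t => g t * stieltjes g t^-1)).
Proof.
apply: (@integrable_mulk R g (fun t => stieltjes g t^-1)) => //.
  by apply: measurableT_comp; [exact: measurable_stieltjes|exact: measurable_funV].
by move=> x; exact: stieltjes_01.
Qed.

Lemma square_modulusE (y : R) : 0 < y ->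
  (\int[lebesgue_measure]_t (g t * kernel2 (t * y))) ^+ 2 +
  (\int[lebesgue_measure]_t (g t * kernel3 (t * y))) ^+ 2 =
  2 * \int[lebesgue_measure]_t (g t * stieltjes g t^-1 * kernel2 (t * y)).
Proof.
move=> y0.
have mg := Rintegrable_measurable _ _ g_int.
(* For t, s > 0 this is g t * g s * t / ((t + s) * (1 + t^2 y^2)), one of the two terms of the
   partial fraction identity. *)
pose f (t s : R) := g t * kernel2 (t * y) * (g s * kernel1 (s * t^-1)).
pose F (p : measurableTypeR R * measurableTypeR R) : \bar R := (f p.1 p.2)%:E.
have mF : measurable_fun setT F.
  apply/measurable_EFinP/measurable_funM; apply: measurable_funM.
  - by apply: measurableT_comp => //; exact: measurable_fst.
  - apply: measurableT_comp; first exact: measurable_kernel2.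
    by apply: measurable_funM => //; exact: measurable_fst.
  - by apply: measurableT_comp => //; exact: measurable_snd.
  - apply: measurableT_comp; first exact: measurable_kernel1.
    apply: measurable_funM; first exact: measurable_snd.
    by apply: measurableT_comp; [exact: measurable_funV|exact: measurable_fst].
have F0 p : (0 <= F p)%E.
  by rewrite lee_fin !mulr_ge0// ltW// ?kernel1_gt0// kernel2_gt0.
have i1 z : lebesgue_measure.-integrable setT (EFin \o (fun s => g s * kernel1 (s * z))).
  exact: (@integrable_gk _ g _ g_int (@measurable_kernel1 R) (@kernel1_01 R)).
have i2 z : lebesgue_measure.-integrable setT (EFin \o (fun s => g s * kernel2 (s * z))).
  exact: (@integrable_gk _ g _ g_int (@measurable_kernel2 R) (@kernel2_01 R)).
have i3 z : lebesgue_measure.-integrable setT (EFin \o (fun s => g s * kernel3 (s * z))).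
  exact: (@integrable_gk _ g _ g_int (@measurable_kernel3 R) (@kernel3_01 R)).
have iu : lebesgue_measure.-integrable setT
    (EFin \o (fun t => g t * stieltjes g t^-1 * kernel2 (t * y))).
  exact: (@integrable_gk _ _ _ integrable_g_stieltjes
    (@measurable_kernel2 R) (@kernel2_01 R)).
have if_ t : lebesgue_measure.-integrable setT (EFin \o f t).
  exact: (integrableZl measurableT (g t * kernel2 (t * y)) (i1 t^-1)).
have fE t : \int[lebesgue_measure]_s f t s = g t * stieltjes g t^-1 * kernel2 (t * y).
  by rewrite /f RintegralZl// -/(stieltjes g t^-1) mulrAC.
set a := \int[lebesgue_measure]_t (g t * kernel2 (t * y)).
set b := \int[lebesgue_measure]_t (g t * kernel3 (t * y)).
(* The partial fraction identity solved for [f t s]: integrating in t then reduces to integrals of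
   [f s] in its second variable, already known from [fE]. *)
have fC t s : f t s = (g s * kernel2 (s * y)) * (g t * kernel2 (t * y)) +
    (g s * kernel3 (s * y)) * (g t * kernel3 (t * y)) - f s t.
  have [t0|t0] := leP t 0; first by rewrite /f (g_le0 _ t0); ring.
  have [s0|s0] := leP s 0; first by rewrite /f (g_le0 _ s0); ring.
  rewrite /f /kernel1 /kernel2 /kernel3 !gtr0_norm ?mulr_gt0 ?invr_gt0//.
  field.
  by rewrite !gt_eqF ?addr_gt0 ?exprn_gt0 ?mulr_gt0.
have fCE s : \int[lebesgue_measure]_t f t s =
    (a * (g s * kernel2 (s * y)) + b * (g s * kernel3 (s * y))) -
    g s * stieltjes g s^-1 * kernel2 (s * y).
  under eq_Rintegral do rewrite fC.
  rewrite RintegralB//; last exact: integrable_comb2.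
  by rewrite Rintegral_comb2// fE -/a -/b [a * _]mulrC [b * _]mulrC.
have if2 s : lebesgue_measure.-integrable setT (EFin \o f ^~ s).
  rewrite (_ : f ^~ s = (fun t => (g s * kernel2 (s * y)) * (g t * kernel2 (t * y)) +
    (g s * kernel3 (s * y)) * (g t * kernel3 (t * y))) \- f s).
    exact: (integrableB measurableT (integrable_comb2 _ _ _ (g s * kernel2 (s * y))
      (g s * kernel3 (s * y)) (i2 y) (i3 y)) (if_ s)).
  by apply/funext => t; exact: fC.
(* Writing J for the integral on the right of the claim, the two orders of integration give J = a^2
   + b^2 - J. *)
have := fubini_tonelli (m1 := @lebesgue_measure R) (m2 := @lebesgue_measure R) F mF F0.
have -> : (fun t => (\int[lebesgue_measure]_s F (t, s))%E) =
    EFin \o (fun t => g t * stieltjes g t^-1 * kernel2 (t * y)).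
  apply/funext => t /=; rewrite -fE /Rintegral fineK//.
  exact: (integrable_fin_num measurableT (if_ t)).
have -> : (fun s => (\int[lebesgue_measure]_t F (t, s))%E) =
    EFin \o (fun s => (a * (g s * kernel2 (s * y)) + b * (g s * kernel3 (s * y))) -
    g s * stieltjes g s^-1 * kernel2 (s * y)).
  apply/funext => s /=; rewrite -fCE /Rintegral fineK//.
  exact: (integrable_fin_num measurableT (if2 s)).
move=> /(congr1 fine).
rewrite -[fine _]/(Rintegral _ _ _) -[in RHS]/(Rintegral _ _ _).
rewrite RintegralB//; last exact: integrable_comb2.
by rewrite Rintegral_comb2// -/a -/b; lra.
Qed.

End square_modulus.

(** * Differentiation under the integral sign *)

Lemma is_derive_kernel2 (R : realType) (t x : R) :
  is_derive x 1 (fun x => kernel2 (t * x))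
    (- (2 * t ^+ 2 * x) / (1 + (t * x) ^+ 2) ^+ 2).
Proof.
have d1 : is_derive x 1 (fun x : R => t * x) t.
  apply/is_derive1_caratheodory; exists (cst t); split => //.
  - by move=> z; rewrite -mulrBr.
  - exact: cst_continuous.
have d2 : is_derive (t * x) 1 (fun v : R => 1 + v ^+ 2) (2 * (t * x)).
  apply/is_derive1_caratheodory; exists (fun z => z + t * x); split.
  - by move=> z; ring.
  - by apply: continuousD; [exact: cvg_id|exact: cst_continuous].
  - by rewrite mulr2n mulrDl mul1r.
have h : 1 + (t * x) ^+ 2 != 0 by rewrite gt_eqF// ltr_pwDl ?sqr_ge0.
have d3 := is_deriveV (f := fun v => 1 + v ^+ 2) h d2.
have := is_derive1_comp d3 d1.
by congr (is_derive _ _ _ _); rewrite /GRing.scale/=; field.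
Qed.

Lemma derivable_integral_kernel2 (R : realType) (g : R -> R) (y : R) :
  (forall t, 0 <= g t) -> (forall t, t <= 0 -> g t = 0) ->
  (forall t, 1 <= t -> g t = 0) ->
  lebesgue_measure.-integrable setT (EFin \o g) -> 0 < y ->
  derivable (fun y => \int[lebesgue_measure]_t (g t * kernel2 (t * y))) y 1.
Proof.
move=> g0 gl gr ig y0.
pose f x t := g t * kernel2 (t * x).
have df (x t : R) : is_derive x 1 (f ^~ t)
    (g t * (- (2 * t ^+ 2 * x) / (1 + (t * x) ^+ 2) ^+ 2)).
  have := is_deriveZ (g t) (is_derive_kernel2 _ t x).
  by [].
(* Domination for x in []0, 2 * y[]: the support of [g] gives 0 < t < 1 and the denominator is at
   least 1, so the derivative in x is at most g t * 2 t^2 x <= g t * (4 * y) in absolute value. *)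
apply: (@derivable_under_integral R _ _ lebesgue_measure f setT measurableT y 0 (2 * y)
  _ _ _ (fun t => g t * (4 * y))).
- by rewrite /= in_itv/= y0/= ltr_pMl// ltr1n.
- move=> x _.
  exact: (@integrable_gk _ g _ ig (@measurable_kernel2 R) (@kernel2_01 R)).
- by move=> x t _ _; have [] := df x t.
- by move=> t; rewrite mulr_ge0// mulr_ge0// ltW.
- rewrite (_ : EFin \o _ = (fun t => (4 * y)%:E * (EFin \o g) t)%E).
    exact: integrableZl.
  by apply/funext => t /=; rewrite mulrC.
- move=> x t; rewrite /= in_itv/= => /andP[x0 xy] _.
  rewrite partial1of2E (@derive_val _ _ _ _ _ _ _ (df x t)).
  have [t0|t0] := leP t 0; first by rewrite gl// !mul0r normr0.
  have [t1|t1] := leP 1 t; first by rewrite gr// !mul0r normr0.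
  have h : 1 <= (1 + (t * x) ^+ 2) ^+ 2 by rewrite exprn_ege1// lerDl sqr_ge0.
  have h0 : 0 < (1 + (t * x) ^+ 2) ^+ 2 by apply: lt_le_trans h.
  rewrite normrM (ger0_norm (g0 t)) ler_wpM2l// normrM normrN.
  rewrite ger0_norm ?invr_ge0 ?(ltW h0)// ler_pdivrMr// ger0_norm; last first.
    by rewrite !mulr_ge0// ?sqr_ge0// ltW.
  apply: (@le_trans _ _ (4 * y)); last by rewrite ler_peMr// mulr_ge0// ltW.
  have tt : t ^+ 2 <= 1 by rewrite expr_le1// ltW.
  have := sqr_ge0 t; nra.
Qed.

(** * The modulus on the imaginary axis and logarithmic derivatives *)

Lemma modulus_on_imaginary_axisE (R : realType) (sigma : R -> R) (y : R) : 0 < y ->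
  let g := (sigma \_ `]0, 1[) in
  modulus_on_imaginary_axis (markov_transform sigma) y =
  Num.sqrt ((\int[lebesgue_measure]_t (g t * kernel2 (t * y))) ^+ 2 +
            (\int[lebesgue_measure]_t (g t * kernel3 (t * y))) ^+ 2).
Proof.
move=> y0 /=.
rewrite /modulus_on_imaginary_axis /markov_transform /cintegral normc_def /=.
congr (Num.sqrt (_ ^+ 2 + _ ^+ 2)); rewrite Rintegral_mkcond; apply: eq_Rintegral => t _;
  rewrite /patch; case: ifPn => [|_]; rewrite ?mul0r// inE/= in_itv/= => /andP[t0 _].
- by rewrite /kernel2; field; rewrite gt_eqF// ltr_pwDl ?sqr_ge0.
- rewrite /kernel3 gtr0_norm ?mulr_gt0//; field; by rewrite gt_eqF// ltr_pwDl ?sqr_ge0.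
Qed.

(** For y <= x, log-concavity makes p l = w (l * y) * w x - w (l * x) * w y non-negative for l > 1,
    and p 1 = 0. So p has non-negative derivative at 1, which is the claim after division by w x * w
    y. *)
Lemma log_concave_log_derive (R : realType) (w : R -> R) :
  (forall y : R, 0 < y -> 0 < w y) ->
  (forall y : R, 0 < y -> derivable w y 1) ->
  log_concave_log w ->
  {in `]0, +oo[%R &, nonincreasing_fun (fun y : R => y * derive1 w y / w y)}.
Proof.
move=> w0 dw lw y x; rewrite !in_itv/= !andbT => y0 x0 yx.
pose p (l : R) := w (l * y) * w x - w (l * x) * w y.
have dscale (z : R) : 0 < z -> is_derive (1 : R) 1 (fun l => w (l * z)) (derive1 w z * z).
  move=> z0; apply: (@is_derive1_comp _ w (fun l => l * z)).
    by rewrite mul1r; apply: DeriveDef; [exact: dw|rewrite derive1E].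
  apply/is_derive1_caratheodory; exists (cst z); split => //.
  - by move=> l; rewrite -mulrBl mulrC.
  - exact: cst_continuous.
have dp : is_derive (1 : R) 1 p (w x * (derive1 w y * y) - w y * (derive1 w x * x)).
  have := is_deriveB (is_deriveZ (w x) (dscale _ y0)) (is_deriveZ (w y) (dscale _ x0)).
  rewrite /GRing.scale/= => h.
  rewrite (_ : p = (w x \*: (fun l => w (l * y)) - w y \*: (fun l => w (l * x)))) //.
  by apply/funext => l; rewrite /p [_ * w x]mulrC [_ * w y]mulrC.
(* [G] is the slope of [p] from 1, continuous at 1 with value the derivative; a negative value there
   would persist at 1 + e / 2, against [Gge]. *)
have [G [GE Gc G1]] := (is_derive1_caratheodory _ _ _).1 dp.
have p1 : p 1 = 0 by rewrite /p !mul1r mulrC subrr.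
have Gge l : 1 < l -> 0 <= G l.
  move=> l1; have l0 : 0 < l by apply: lt_trans l1.
  have := GE l; rewrite p1 subr0 => pG.
  rewrite -(pmulr_lge0 (x := l - 1)) ?subr_gt0// -pG subr_ge0.
  rewrite (mulrC l y) (mulrC l x) (mulrC (w (x * l))).
  have := lw (y * l) (x * l) l (mulr_gt0 y0 l0).
  rewrite !mulfK ?gt_eqF//; apply; last exact: ltW.
  by rewrite ler_pM2r.
suff : 0 <= w x * (derive1 w y * y) - w y * (derive1 w x * x).
  rewrite subr_ge0 => h; rewrite ler_pdivrMr ?w0// mulrAC ler_pdivlMr ?w0//.
  by move: h; rewrite -!mulrA => h; lra.
rewrite -G1 leNgt; apply/negP => G0.
have : nbhs (1 : R) [set l | G l < 0] by exact: cvgr_lt (G 1) Gc 0 G0.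
move=> /nbhs_ballP[e /= e0 he].
have : G (1 + e / 2) < 0.
  apply: he; rewrite /ball/= opprD addrA subrr sub0r normrN gtr0_norm ?divr_gt0//.
  by rewrite ltr_pdivrMr// ltr_pMr// ltr1n.
by apply/negP; rewrite -leNgt; apply: Gge; rewrite ltrDl divr_gt0.
Qed.

(** * Assembly for [sigma] extended by zero *)

Theorem theorem1p5 (R : realType) (sigma : R -> R)
  (sigma_pos : forall t : R, 0 < t < 1 -> 0 < sigma t)
  (sigma_derivable : forall t : R, 0 < t < 1 -> derivable sigma t 1)
  (sigma_C1 : forall t : R, 0 < t < 1 -> {for t, continuous (derive1 sigma)})
  (sigma_int : (\int[lebesgue_measure]_(t in `]0%R, 1%R[) (sigma t)%:E = 1)%E)
  (sigma_decr : {in `]0, 1[%R &,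
    nonincreasing_fun (fun t : R => t * derive1 sigma t / sigma t)}) :
  let f := markov_transform sigma in
  let w := modulus_on_imaginary_axis f in
  [/\ forall y : R, 0 < y -> 0 < w y,
      forall y : R, 0 < y -> derivable w y 1
    & {in `]0, +oo[%R &,
        nonincreasing_fun (fun y : R => y * derive1 w y / w y)}].
Proof.
move=> f w.
pose g : R -> R := (sigma \_ `]0, 1[).
have gE (t : R) : 0 < t < 1 -> g t = sigma t.
  by move=> t01; rewrite /g patchE mem_set//= in_itv.
have gN (t : R) : ~~ (0 < t < 1) -> g t = 0.
  by move=> t01; rewrite /g patchE memNset//= in_itv/=; exact/negP.
have g_ge0 (t : R) : 0 <= g t.
  by have [t01|t01] := boolP (0 < t < 1); [rewrite gE// ltW// sigma_pos|rewrite gN].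
have g_le0 (t : R) : t <= 0 -> g t = 0 by move=> t0; rewrite gN// ltNge t0.
have g_ge1 (t : R) : 1 <= t -> g t = 0 by move=> t0; rewrite gN// [t < 1]ltNge t0 andbF.
have sigma_meas : measurable_fun (`]0, 1[%classic : set R) sigma.
  apply: open_continuous_measurable_fun => [|t]; first exact: interval_open.
  rewrite inE/= in_itv/= => /sigma_derivable.
  by move/derivable1_diffP/differentiable_continuous.
have g_int : lebesgue_measure.-integrable setT (EFin \o g).
  rewrite (_ : EFin \o g = (EFin \o sigma) \_ `]0, 1[); last first.
    by rewrite restrict_EFin.
  have mD : measurable (`]0, 1[%classic : set R) by exact: measurable_itv.
  refine ((integrable_mkcond (mu := lebesgue_measure) (EFin \o sigma) mD).1 _).
  apply/integrableP; split.
    exact/measurable_EFinP.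
  apply: le_lt_trans (ltry 1); rewrite -sigma_int le_eqVlt; apply/orP; left.
  apply/eqP/eq_integral => t.
  by rewrite inE/= in_itv/= => t01; rewrite ger0_norm// ltW// sigma_pos.
have g_int1 : \int[lebesgue_measure]_t g t = 1.
  by rewrite /g -Rintegral_mkcond /Rintegral sigma_int.
have g_lc : log_concave_log g.
  move=> t s l t0 ts l1.
  (* For s >= 1 the left side vanishes; otherwise all four points lie in []0, 1[]. *)
  have [s1|s1] := leP 1 s; first by rewrite (g_ge1 s)// mulr0 mulr_ge0.
  have l0 : 0 < l by apply: lt_le_trans l1.
  have s0 : 0 < s by apply: lt_le_trans ts.
  have t1 : t < 1 by apply: le_lt_trans s1.
  rewrite !gE ?t0 ?s0 ?divr_gt0//= ?ltr_pdivrMr ?mul1r//; last 2 first.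
  - exact: lt_le_trans l1.
  - exact: lt_le_trans l1.
  exact: log_concave_log_of_derive.
pose h (t : R) := g t * stieltjes g t^-1.
have h_ge0 (t : R) : 0 <= h t.
  by rewrite mulr_ge0//; have /andP[] := stieltjes_01 _ _ g_ge0 g_int g_int1 t^-1.
have h_le0 (t : R) : t <= 0 -> h t = 0 by move=> t0; rewrite /h g_le0 ?mul0r.
have h_ge1 (t : R) : 1 <= t -> h t = 0 by move=> t0; rewrite /h g_ge1 ?mul0r.
have h_int : lebesgue_measure.-integrable setT (EFin \o h).
  exact: integrable_g_stieltjes.
(* First convolution, with [kernel1], followed by inversion and the product with [g]. *)
have h_lc : log_concave_log h.
  apply: log_concave_logM => //.
    by move=> t; have /andP[] := stieltjes_01 _ _ g_ge0 g_int g_int1 t^-1.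
  apply: log_concave_logV; apply: log_concave_log_integral => //.
  - exact: measurable_kernel1.
  - exact: kernel1_01.
  - exact: kernel1_gt0.
  - exact: kernel1_tp.
pose I y := \int[lebesgue_measure]_t (h t * kernel2 (t * y)).
(* Second convolution, now of [h] with [kernel2]. *)
have I_lc : log_concave_log I.
  apply: log_concave_log_integral => //.
  - exact: measurable_kernel2.
  - exact: kernel2_01.
  - exact: kernel2_gt0.
  - exact: kernel2_tp.
have E (y : R) : 0 < y -> (\int[lebesgue_measure]_t (g t * kernel2 (t * y))) ^+ 2 +
  (\int[lebesgue_measure]_t (g t * kernel3 (t * y))) ^+ 2 = 2 * I y.
  exact: square_modulusE.
have wE (y : R) : 0 < y -> w y = Num.sqrt (2 * I y).
  by move=> y0; rewrite -E// /w /f modulus_on_imaginary_axisE.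
have I_gt0 (y : R) : 0 < y -> 0 < 2 * I y.
  move=> y0; rewrite -E// ltr_pwDl ?sqr_ge0// exprn_gt0//.
  (* On []0, 1[] one has kernel2 (t * y) >= kernel2 y, and [g] has integral 1, so the real part of
     f(iy) is at least [kernel2 y]. *)
  apply: (@lt_le_trans _ _ (kernel2 y)); first exact: kernel2_gt0.
  rewrite -[leLHS]mulr1 -g_int1 -RintegralZl//; apply: le_Rintegral => //.
  - exact: (integrableZl measurableT (kernel2 y) g_int).
  - exact: (@integrable_gk _ g _ g_int (@measurable_kernel2 R) (@kernel2_01 R)).
  move=> t _; have [/andP[t0 t1]|t01] := boolP (0 < t < 1); last first.
    by rewrite gN// mulr0 mul0r.
  rewrite mulrC ler_wpM2l// lef_pV2 ?posrE ?ltr_pwDl ?sqr_ge0//.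
  by rewrite lerD2l ler_sqr ?nnegrE ?mulr_ge0 ?ler_piMl// ltW.
have w_gt0 (y : R) : 0 < y -> 0 < w y.
  by move=> y0; rewrite wE// sqrtr_gt0 I_gt0.
have w_der (y : R) : 0 < y -> derivable w y 1.
  move=> y0.
  (* The formula [wE] holds only on the positive reals, which contain a neighbourhood of [y]. *)
  apply: (@near_eq_derivable _ _ _ (fun y => Num.sqrt (2 * I y))).
    by near=> z; rewrite wE//; near: z; exact: lt_nbhsr.
  have dI : is_derive y 1 (fun y => 2 * I y) (2 * derive1 I y).
    have dI : is_derive y 1 I (derive1 I y).
      apply: DeriveDef; last by rewrite derive1E.
      exact: derivable_integral_kernel2.
    exact: (is_deriveZ (2 : R) dI).
  by have [] := is_derive1_comp (g := fun y => 2 * I y) (is_derive1_sqrt (I_gt0 _ y0)) dI.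
split => //; apply: log_concave_log_derive => // t s l t0 ts l1.
have l0 : 0 < l by apply: lt_le_trans l1.
have s0 : 0 < s by apply: lt_le_trans ts.
(* Monotonicity of the square root transfers log-concavity from 2 * I to w. *)
rewrite !wE ?divr_gt0// -!sqrtrM ?(ltW (I_gt0 _ _)) ?divr_gt0//.
apply: ler_wsqrtr.
rewrite mulrACA [leRHS]mulrACA ler_wpM2l//; exact: I_lc.
Unshelve. all: by end_near. Qed.
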